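(* $\mathbb{E}\cap\mathbb{R}^3$ is the open tetrahedron with vertices $(1,1,1)$, $(1,-1,-1)$, $(-1,1,-1)$ and $(-1,-1,1)$.
   Context: The tetrablock is $\mathbb{E}=\{x\in\mathbb{C}^3: 1-x_1z-x_2w+x_3zw\ne0 \text{ whenever } z,w\in\mathbb{C},\ |z|\le1,\ |w|\le1\}$. The open tetrahedron is the interior in $\mathbb{R}^3$ of the convex hull of its vertices. *)

(* Defs.v *)
From HB Require Import structures.
From mathcomp Require Import all_boot all_order all_algebra.
From mathcomp Require Import complex.
From mathcomp Require Import boolp classical_sets reals topology normedtype convex.

Set Implicit Arguments.
Unset Strict Implicit.
Unset Printing Implicit Defensive.

Import Order.TTheory GRing.Theory Num.Theory.
Import numFieldNormedType.Exports.

Local Open Scope classical_set_scope.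
Local Open Scope ring_scope.
Local Open Scope complex_scope.

Definition vec3 (T : nzRingType) (a b c : T) : 'rV[T]_3 :=
  \row_(j < 3) [:: a; b; c]`_j.

(* The coordinates x_1, x_2, x_3 are [x 0 0], [x 0 1], [x 0 2]. *)
Definition tetrablock (R : realType) : set 'rV[R[i]]_3 :=
  [set x | forall z w : R[i], `|z| <= 1 -> `|w| <= 1 ->
     1 - x 0 0 * z - x 0 1 * w + x 0 2 * z * w != 0].

Definition real_points (R : realType) : set 'rV[R[i]]_3 :=
  range (map_mx (real_complex R) : 'rV[R]_3 -> 'rV[R[i]]_3).

Definition convex_hull (R : numDomainType) (M : lmodType R) (A : set M) : set M :=
  smallest (@convex_set R M) A.

Definition open_tetrahedron (R : realType) (a b c d : 'rV[R]_3) :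
    set 'rV[R]_3 :=
  interior (convex_hull [set a; b; c; d]).

(* Main.v *)
(* The four values of 1 - x1 z - x2 w + x3 z w at z, w = 1 or -1 are, up to the
   factor 4, the barycentric coordinates of x with respect to the tetrahedron.
   If x is real and the form has no zero on the closed bidisc, then it is
   positive on the real square [-1, 1]^2 by the intermediate value theorem,
   since its value at the origin is 1.  Conversely, if the four values are
   positive, then |x2 - x3 z| < |1 - x1 z| for |z| <= 1, so that
   1 - x1 z = w (x2 - x3 z) is impossible with |w| <= 1. *)
Require Import Defs.
From HB Require Import structures.
From mathcomp Require Import all_boot all_order all_algebra.
From mathcomp Require Import complex.
From mathcomp Require Import boolp classical_sets reals topology normedtype convex.
From mathcomp Require Import interval_inference ring lra.

Set Implicit Arguments.
Unset Strict Implicit.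
Unset Printing Implicit Defensive.

Import Order.TTheory GRing.Theory Num.Theory.
Import numFieldNormedType.Exports.

Local Open Scope classical_set_scope.
Local Open Scope ring_scope.
Local Open Scope complex_scope.

Definition bilin (T : nzRingType) (x : 'rV[T]_3) (z w : T) : T :=
  1 - x 0 0 * z - x 0 1 * w + x 0 2 * z * w.

(* The vertices are the points [(s, t, s * t)] with [s, t = 1] or [-1], and the
   facet opposite to this vertex lies in the plane [bilin x (- s) (- t) = 0]:
   at [(s, t, s * t)], [bilin x s' t'] equals [(1 - s * s') * (1 - t * t')]. *)
Definition facets_pos (R : realType) (x : 'rV[R]_3) : Prop :=
  [/\ 0 < bilin x 1 1, 0 < bilin x 1 (-1), 0 < bilin x (-1) 1 &
      0 < bilin x (-1) (-1)].

Definition facets_ge0 (R : realType) : set 'rV[R]_3 :=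
  [set x | [/\ 0 <= bilin x 1 1, 0 <= bilin x 1 (-1), 0 <= bilin x (-1) 1 &
      0 <= bilin x (-1) (-1)]].

Lemma ord3P (i : 'I_3) : [\/ i = 0, i = 1 | i = 2].
Proof.
by case: i => [[|[|[|//]]] ?]; [constructor 1|constructor 2|constructor 3];
   apply/val_inj.
Qed.

Lemma row3P (T : nzRingType) (x y : 'rV[T]_3) :
  x 0 0 = y 0 0 -> x 0 1 = y 0 1 -> x 0 2 = y 0 2 -> x = y.
Proof.
by move=> h0 h1 h2; apply/rowP => i; case: (ord3P i) => ->.
Qed.

Lemma bilin_map (R : realType) (x : 'rV[R]_3) (z w : R) :
  bilin (map_mx (real_complex R) x) z%:C w%:C = (bilin x z w)%:C.
Proof.
by rewrite /bilin !mxE rmorphD !rmorphB !rmorphM rmorph1.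
Qed.

(* On [t |-> bilin x (t * s) (t * u)], nonvanishing on [0, 1] keeps the sign
   of the value 1 at the origin. *)
Lemma bilin_nonzero_pos (R : realType) (x : 'rV[R]_3) (s u : R) :
  (forall t : R, 0 <= t <= 1 -> bilin x (t * s) (t * u) != 0) ->
  0 < bilin x s u.
Proof.
move=> nz; rewrite ltNge; apply/negP => le0.
pose p : {poly R} :=
  1 - (x 0 0 * s + x 0 1 * u) *: 'X + (x 0 2 * s * u) *: 'X^2.
have pE t : p.[t] = bilin x (t * s) (t * u).
  by rewrite /p !hornerE /= /bilin; ring.
have p0 : p.[0] = 1 by rewrite pE /bilin !mul0r !mulr0 !subr0 addr0.
have p1 : p.[1] = bilin x s u by rewrite pE !mul1r.
(* [poly_ivt] wants a nonpositive value at the left end, hence [- p]. *)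
have [||t t01] := @poly_ivt R (- p) 0 1; rewrite ?ler01//.
  by rewrite !hornerN p0 p1 oppr_le0 ler01 oppr_ge0.
by rewrite rootN rootE pE; apply/negP/nz.
Qed.

Lemma norm_le1 (R : realType) (z : R[i]) :
  (`|z| <= 1) = (complex.Re z ^+ 2 + complex.Im z ^+ 2 <= 1).
Proof.
rewrite normc_def lecR -[in LHS]sqrtr1 ler_sqrt ?ltr01//.
Qed.

Lemma tetrablock_facets (R : realType) (x : 'rV[R]_3) :
  tetrablock (map_mx (real_complex R) x) -> facets_pos x.
Proof.
move=> tx.
have pos (s u : R) : s ^+ 2 = 1 -> u ^+ 2 = 1 -> 0 < bilin x s u.
  move=> s1 u1; apply: bilin_nonzero_pos => t /andP[t0 t1].
  (* The segment from the origin to the corner [(s, u)] stays in the closed bidisc. *)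
  have le1 (r : R) : r ^+ 2 = 1 -> `|(t * r)%:C| <= 1.
    by move=> r1; rewrite norm_le1 /= exprMn r1; nra.
  have /eqP := tx _ _ (le1 _ s1) (le1 _ u1).
  by move=> nz; apply/eqP => b0; apply: nz; rewrite -/(bilin _ _ _) bilin_map b0.
by split; apply: pos; rewrite ?sqrrN expr1n.
Qed.

Lemma affine_pos (R : realType) (a b s : R) :
  0 < a + b -> 0 < a - b -> s ^+ 2 <= 1 -> 0 < a + b * s.
Proof.
move=> h1 h2 hs; have : -1 <= s <= 1 by apply/andP; split; nra.
move=> /andP[s1 s2]; nra.
Qed.

(* With [r = |z|^2] and [s = Re z], the inequality is
   [|b - c z|^2 < |1 - a z|^2].  Both sides are affine in [r], so it suffices
   to check it at [r = s ^+ 2] and [r = 1], where their difference is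
   respectively a product of two affine functions of [s] and affine in [s]. *)
Lemma modulus_gap (R : realType) (a b c r s : R) :
  0 < 1 - a - b + c -> 0 < 1 - a + b - c ->
  0 < 1 + a - b - c -> 0 < 1 + a + b + c ->
  s ^+ 2 <= r -> r <= 1 ->
  b ^+ 2 - 2 * (b * c) * s + c ^+ 2 * r < 1 - 2 * a * s + a ^+ 2 * r.
Proof.
move=> h1 h2 h3 h4 sr r1.
have s1 : s ^+ 2 <= 1 by exact: le_trans r1.
have e0 : 0 < (1 - b + (c - a) * s) * (1 + b + (- a - c) * s).
  by apply: mulr_gt0; apply: affine_pos => //; lra.
have e1 : 0 < (1 - b ^+ 2 + a ^+ 2 - c ^+ 2) + (2 * (b * c - a)) * s.
  apply: affine_pos => //.
    by have := mulr_gt0 h1 h2; congr (0 < _); ring.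
  by have := mulr_gt0 h3 h4; congr (0 < _); ring.
(* Interpolating between [r = s ^+ 2] and [r = 1] uses the weight [1 - s ^+ 2], so the case where
   these endpoints coincide is split off. *)
have [s1'|s1'] := eqVneq (s ^+ 2) 1.
  have -> : r = 1 by apply/eqP; rewrite eq_le r1 -s1'.
  by rewrite -subr_gt0; move: e1; congr (0 < _); ring.
have s1lt : 0 < 1 - s ^+ 2 by rewrite subr_gt0 lt_neqAle s1'.
rewrite -subr_gt0 -(pmulr_rgt0 _ s1lt).
have -> : (1 - s ^+ 2) * (1 - 2 * a * s + a ^+ 2 * r -
                (b ^+ 2 - 2 * (b * c) * s + c ^+ 2 * r)) =
  (1 - r) * ((1 - b + (c - a) * s) * (1 + b + (- a - c) * s)) +
  (r - s ^+ 2) * ((1 - b ^+ 2 + a ^+ 2 - c ^+ 2) + (2 * (b * c - a)) * s).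
  by ring.
have [->|rlt] := eqVneq r 1; first by rewrite subrr mul0r add0r mulr_gt0.
apply: ltr_wpDr; first by rewrite mulr_ge0 ?subr_ge0 ?(ltW e1).
by rewrite mulr_gt0 // subr_gt0 lt_neqAle rlt.
Qed.

Lemma facets_tetrablock (R : realType) (x : 'rV[R]_3) :
  facets_pos x -> tetrablock (map_mx (real_complex R) x).
Proof.
rewrite /facets_pos /bilin => -[h1 h2 h3 h4] [a b] [c d].
rewrite !norm_le1 !mxE /= => ab cd; apply/eqP.
move: (x 0 0) (x 0 1) (x 0 2) h1 h2 h3 h4 => x1 x2 x3 h1 h2 h3 h4.
simpc => -[re im].
have gap := @modulus_gap R x1 x2 x3 (a ^+ 2 + b ^+ 2) a.
have {gap} : x2 ^+ 2 - 2 * (x2 * x3) * a + x3 ^+ 2 * (a ^+ 2 + b ^+ 2) <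
   1 - 2 * x1 * a + x1 ^+ 2 * (a ^+ 2 + b ^+ 2).
  by apply: gap; nra.
(* With [z = a + ib] and [w = c + id], [A] is |1 - x1 z|^2 and [B] is |x2 - x3 z|^2; a zero of the
   form gives [A] = |w|^2 [B], which is at most [B]. *)
set B := (X in X < _); set A := (X in _ < X) => BA.
have AE : A = (c ^+ 2 + d ^+ 2) * B.
  have e1 : 1 - x1 * a = (x2 - x3 * a) * c + x3 * b * d by lra.
  have e2 : - x1 * b = (x2 - x3 * a) * d - x3 * b * c by lra.
  have -> : A = (1 - x1 * a) ^+ 2 + (- x1 * b) ^+ 2 by rewrite /A; ring.
  by rewrite e1 e2 /B; ring.
have B0 : 0 <= B.
  have -> : B = (x2 - x3 * a) ^+ 2 + (x3 * b) ^+ 2 by rewrite /B; ring.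
  by rewrite addr_ge0 ?sqr_ge0.
move: BA; rewrite AE; nra.
Qed.

Lemma convex_setP (R : realType) (C : set 'rV[R]_3) :
  convex_set C <->
  (forall x y t, 0 <= t <= 1 -> C x -> C y -> C (t *: x + (1 - t) *: y)).
Proof.
split=> [cC x y t t01 Cx Cy|cC x y t /set_mem Cx /set_mem Cy]; last first.
  by apply/mem_set/cC => //; rewrite ge0 le1.
have t01' : Itv.spec (@Itv.num_sem R) (Itv.Real `[0, 1]%Z) t.
  by rewrite /= /Itv.num_sem/= realE in_itv/=; case/andP: t01 => -> ->.
by have /set_mem := cC x y (Itv.mk t01') (mem_set Cx) (mem_set Cy).
Qed.

Lemma facets_ge0_convex (R : realType) : convex_set (@facets_ge0 R).
Proof.
apply/convex_setP => x y t /andP[t0 t1] [x1 x2 x3 x4] [y1 y2 y3 y4].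
have t1' : 0 <= 1 - t by lra.
have bilinD z w : bilin (t *: x + (1 - t) *: y) z w =
    t * bilin x z w + (1 - t) * bilin y z w.
  by rewrite /bilin !mxE; ring.
by split; rewrite bilinD addr_ge0 ?mulr_ge0.
Qed.

Section Tetrahedron.
Variable R : realType.

Let vertices : set 'rV[R]_3 :=
  [set vec3 1 1 1; vec3 1 (-1) (-1); vec3 (-1) 1 (-1); vec3 (-1) (-1) 1].

Lemma hull_facets_ge0 : convex_hull vertices `<=` @facets_ge0 R.
Proof.
apply: smallest_sub; first exact: facets_ge0_convex.
move=> _ [[[->|->]|->]|->]; rewrite /facets_ge0 /bilin /= !mxE /=; split; lra.
Qed.

Lemma facets_pos_hull : @facets_pos R `<=` convex_hull vertices.
Proof.
move=> x; rewrite /facets_pos /bilin => -[h1 h2 h3 h4] C [/convex_setP cC vC].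
have p : 0 < 1 + x 0 0 by lra.
have q : 0 < 1 - x 0 0 by lra.
(* The point lies on a segment joining the opposite edges in the planes x1 = 1 and x1 = -1; [l] and
   [m] are the weights along these edges. *)
pose l := (1 + x 0 0 + x 0 1 + x 0 2) / (2 * (1 + x 0 0)).
pose m := (1 - x 0 0 + x 0 1 - x 0 2) / (2 * (1 - x 0 0)).
have l01 : 0 <= l <= 1.
  by rewrite /l ler_pdivlMr ?ler_pdivrMr ?mul0r ?mul1r; lra.
have m01 : 0 <= m <= 1.
  by rewrite /m ler_pdivlMr ?ler_pdivrMr ?mul0r ?mul1r; lra.
have Cl : C (l *: vec3 1 1 1 + (1 - l) *: vec3 1 (-1) (-1)).
  by apply: cC => //; apply: vC; [left; left; left|left; left; right].
have Cm : C (m *: vec3 (-1) 1 (-1) + (1 - m) *: vec3 (-1) (-1) 1).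
  by apply: cC => //; apply: vC; [left; right|right].
have k01 : 0 <= (1 + x 0 0) / 2 <= 1 by apply/andP; split; lra.
have := cC _ _ _ k01 Cl Cm; congr (C _).
have [p0 q0] : 1 + x 0 0 != 0 /\ 1 - x 0 0 != 0 by split; apply: lt0r_neq0.
apply: row3P; rewrite !mxE /= /l /m; field; exact/andP.
Qed.

(** The hull lies between [facets_pos] and [facets_ge0]. This suffices: [facets_pos] is open, and at
    an interior point of [facets_ge0] no facet form can vanish. *)
Lemma open_tetrahedronE :
  open_tetrahedron (vec3 1 1 1) (vec3 1 (-1) (-1))
                   (vec3 (-1) 1 (-1)) (vec3 (-1) (-1) 1) = @facets_pos R.
Proof.
apply/seteqP; split => x; rewrite /open_tetrahedron /interior /=.
  move=> /nbhs_ballP[e /= e0 xe].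
  have pos (s u : R) : s ^+ 2 = 1 -> u ^+ 2 = 1 ->
      (forall y, @facets_ge0 R y -> 0 <= bilin y s u) -> 0 < bilin x s u.
    move=> s1 u1 fge.
    (* Each coordinate moves by [e / 2] in the direction that lowers the form at [(s, u)], by
       [3 * e / 2] in total. *)
    pose y := vec3 (x 0 0 + e / 2 * s) (x 0 1 + e / 2 * u)
                   (x 0 2 - e / 2 * (s * u)).
    have ball_y : ball x e y.
      split=> // i j; rewrite ord1; rewrite /ball /= /y.
      have h (r : R) : r ^+ 2 = 1 -> `|e / 2 * r| < e.
        by move=> r1; rewrite ltr_norml; apply/andP; split; nra.
      have su1 : (- (s * u)) ^+ 2 = 1 by rewrite sqrrN exprMn s1 u1 mulr1.
      case: (ord3P j) => ->; rewrite !mxE /= opprD addNKr.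
      - by rewrite normrN h.
      - by rewrite normrN h.
      - by rewrite -mulrN normrN h.
    have := fge _ (hull_facets_ge0 (xe _ ball_y)).
    rewrite /bilin /y !mxE /=.
    have -> : 1 - (x 0 0 + e / 2 * s) * s - (x 0 1 + e / 2 * u) * u +
        (x 0 2 - e / 2 * (s * u)) * s * u =
        (1 - x 0 0 * s - x 0 1 * u + x 0 2 * s * u)
        - e / 2 * (s ^+ 2 + u ^+ 2 + s ^+ 2 * u ^+ 2) by ring.
    rewrite s1 u1; lra.
  by split; apply: pos; rewrite ?sqrrN ?expr1n// => y [].
move=> [h1 h2 h3 h4].
pose m := Num.min (Num.min (bilin x 1 1) (bilin x 1 (-1)))
                  (Num.min (bilin x (-1) 1) (bilin x (-1) (-1))).
have m0 : 0 < m by rewrite !lt_min h1 h2 h3 h4.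
have : m <= m by [].
rewrite {2}/m !le_min => /andP[/andP[g1 g2] /andP[g3 g4]].
(* Each facet form has coefficients 1 or -1, so three coordinate changes below [m / 3] alter it by
   less than [m]. *)
have e0 : 0 < m / 3 by rewrite divr_gt0.
apply/nbhs_ballP; exists (m / 3) => //= y [_ xy]; apply: facets_pos_hull.
have := (xy 0 0, xy 0 1, xy 0 2); rewrite /ball /= !ltr_norml.
move: m g1 g2 g3 g4 {m0 e0 xy} => m.
rewrite /facets_pos /bilin => g1 g2 g3 g4 [[/andP[? ?] /andP[? ?]] /andP[? ?]].
by split; lra.
Qed.

End Tetrahedron.

Theorem theorem2p8 (R : realType) :
  @tetrablock R `&` @real_points R =
  map_mx (real_complex R) @`
    open_tetrahedron (vec3 1 1 1) (vec3 1 (-1) (-1))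
                     (vec3 (-1) 1 (-1)) (vec3 (-1) (-1) 1).
Proof.
rewrite open_tetrahedronE; apply/seteqP; split => [t [tx [x _ xt]]|_ [x px <-]].
  by exists x; rewrite -?xt in tx *; first exact: tetrablock_facets.
by split; [exact: facets_tetrablock|exists x].
Qed.
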